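(* Let $\mu\ge0$, $\bar H^t\in\mathbb{R}^{m\times n_yL'}$, $\bar q^t\in\mathbb{R}^m$, $\bar{\mathbf{y}}^t\in\mathbb{R}^{n_yL'}$, $g^t\in\mathbb{R}^M$, and $$\Sigma^t:=\Gamma P_t\Gamma^\top+\Gamma_w\Sigma_w\Gamma_w^\top+\|g^t\|_2^2\,T,\qquad T:=\sigma^2\left(\Gamma\Gamma^\top+\mathbb{I}_{n_yL'}\right).$$ Define $$\mathbf{c}_1:=\sqrt{\mathrm{diag}\left(\bar H^t\left(\Gamma P_t\Gamma^\top+\Gamma_w\Sigma_w\Gamma_w^\top\right)(\bar H^t)^\top\right)},\qquad \mathbf{c}_2:=\sqrt{\mathrm{diag}\left(\bar H^tT(\bar H^t)^\top\right)}.$$ Then the second-order cone constraint $$\bar q^t-\bar H^t\bar{\mathbf{y}}^t\ \ge\ \mu\left(\mathbf{c}_1+\mathbf{c}_2\|g^t\|_2\right)$$ guarantees the satisfaction of $$\bar q^t-\bar H^t\bar{\mathbf{y}}^t\ \ge\ \mu\sqrt{\mathrm{diag}\left(\bar H^t\Sigma^t(\bar H^t)^\top\right)}.$$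
   Context: Vector inequalities and square roots of vectors are element-wise; $\mathrm{diag}(\cdot)$ of a square matrix is the vector of its diagonal elements. $\bar{\mathbf{y}}^t$ and $\Sigma^t$ are the mean and covariance of a stochastic output prediction over $L'$ steps for a system with $n_y$ outputs. $P_t\in\mathbb{R}^{n_yL_0\times n_yL_0}$ and $\Sigma_w\in\mathbb{R}^{n_wL\times n_wL}$ are covariance matrices (symmetric positive semidefinite) of the past output sequence and of the disturbance sequence; $\Gamma\in\mathbb{R}^{n_yL'\times n_yL_0}$ and $\Gamma_w\in\mathbb{R}^{n_yL'\times n_wL}$ are fixed matrices; $\sigma^2\ge0$ is the output noise variance. $\bar H^t$ and $\bar q^t$ stack $n_c$ linear output constraints for each of the $L'$ prediction steps, so $m=L'n_c$. The scalar $\mu\ge 0$ is the constraint-tightening factor. *)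

(* Defs.v *)
From mathcomp Require Import all_boot all_order all_algebra.

Set Implicit Arguments.
Unset Strict Implicit.
Unset Printing Implicit Defensive.

Import Order.TTheory GRing.Theory Num.Theory.
Local Open Scope ring_scope.

(* Vectors are column vectors; the scalars form an arbitrary real closed
   field R, of which the real numbers are an instance. *)

Definition psdmx (R : rcfType) (n : nat) (A : 'M[R]_n) : Prop :=
  A \is symmetricmx /\ forall x : 'cV[R]_n, 0 <= (x^T *m A *m x) 0 0.

Definition vec_ge (R : rcfType) (n : nat) (u v : 'cV[R]_n) : Prop :=
  forall i, v i 0 <= u i 0.

Definition diagv (R : rcfType) (n : nat) (A : 'M[R]_n) : 'cV[R]_n :=
  \col_i A i i.

(* Num.sqrt is total, with value 0 on negative arguments. *)
Definition sqrtv (R : rcfType) (n : nat) (u : 'cV[R]_n) : 'cV[R]_n :=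
  map_mx Num.sqrt u.

(* The Euclidean norm; the library norm on matrices is the sup norm. *)
Definition norm2 (R : rcfType) (n : nat) (u : 'cV[R]_n) : R :=
  Num.sqrt (\sum_i u i 0 ^+ 2).

(* Main.v *)
(* The claim reduces row by row to sqrt (a + t^2 b) <= sqrt a + t sqrt b for
   t >= 0, where a and b are diagonal entries of the two summands of the
   covariance.  Since x <= (sqrt x)^2 holds even for x < 0, where sqrt x = 0,
   squaring gives this inequality for a and b of any sign. *)
Require Import Defs.
From mathcomp Require Import all_boot all_order all_algebra.

Set Implicit Arguments.
Unset Strict Implicit.
Unset Printing Implicit Defensive.

Import Order.TTheory GRing.Theory Num.Theory.
Local Open Scope ring_scope.

Lemma le_sqr_sqrtr (R : rcfType) (a : R) : a <= Num.sqrt a ^+ 2.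
Proof.
have [a_ge0|a_lt0] := leP 0 a; first by rewrite sqr_sqrtr.
by rewrite (le_trans (ltW a_lt0)) ?sqr_ge0.
Qed.

Lemma sqrtrD_sqrM_le (R : rcfType) (a b t : R) : 0 <= t ->
  Num.sqrt (a + t ^+ 2 * b) <= Num.sqrt a + t * Num.sqrt b.
Proof.
move=> t_ge0.
have tb_ge0 : 0 <= t * Num.sqrt b by rewrite mulr_ge0 ?sqrtr_ge0.
have rhs_ge0 : 0 <= Num.sqrt a + t * Num.sqrt b by rewrite addr_ge0 ?sqrtr_ge0.
(* The right side is nonnegative, hence the root of its own square; monotonicity of [Num.sqrt] then
   leaves only the radicands to compare. *)
rewrite -[leRHS]ger0_norm // -sqrtr_sqr; apply: ler_wsqrtr.
(* The nonnegative cross term of the square is grouped with [Num.sqrt a ^+ 2], where it is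
   dropped. *)
rewrite sqrrD exprMn lerD //.
  by rewrite ler_wpDr ?le_sqr_sqrtr // mulrn_wge0 // mulr_ge0 ?sqrtr_ge0.
by rewrite ler_wpM2l ?sqr_ge0 ?le_sqr_sqrtr.
Qed.

Lemma sqrtv_diagvE (R : rcfType) (n : nat) (A : 'M[R]_n) (i : 'I_n) (j : 'I_1) :
  sqrtv (diagv A) i j = Num.sqrt (A i i).
Proof. by rewrite !mxE. Qed.

Theorem corollary11 (R : rcfType) (ny nw nc L0 L L' M : nat)
    (Gam : 'M[R]_((ny * L')%N, (ny * L0)%N))
    (Gamw : 'M[R]_((ny * L')%N, (nw * L)%N))
    (P : 'M[R]_((ny * L0)%N)) (hP : psdmx P)
    (Sigw : 'M[R]_((nw * L)%N)) (hSigw : psdmx Sigw)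
    (sigma2 : R) (hsigma2 : 0 <= sigma2)
    (mu : R) (hmu : 0 <= mu)
    (H : 'M[R]_((L' * nc)%N, (ny * L')%N))
    (q : 'cV[R]_((L' * nc)%N))
    (y : 'cV[R]_((ny * L')%N))
    (g : 'cV[R]_M) :
  let T := sigma2 *: (Gam *m Gam^T + 1%:M) in
  let Sig0 := Gam *m P *m Gam^T + Gamw *m Sigw *m Gamw^T in
  let Sig := Sig0 + norm2 g ^+ 2 *: T in
  let c1 := sqrtv (diagv (H *m Sig0 *m H^T)) in
  let c2 := sqrtv (diagv (H *m T *m H^T)) in
  vec_ge (q - H *m y) (mu *: (c1 + norm2 g *: c2)) ->
  vec_ge (q - H *m y) (mu *: sqrtv (diagv (H *m Sig *m H^T))).
Proof.
move=> T Sig0 Sig c1 c2 socc i; apply: le_trans (socc i).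
rewrite [leLHS]mxE [leRHS]mxE ler_wpM2l // [leRHS]mxE [X in _ <= _ + X]mxE.
rewrite !sqrtv_diagvE.
(* Conjugation by [H] is linear in the covariance, so each diagonal entry has the form
   [a + t ^+ 2 * b] with [t = norm2 g]. *)
have -> : (H *m Sig *m H^T) i i =
    (H *m Sig0 *m H^T) i i + norm2 g ^+ 2 * (H *m T *m H^T) i i.
  by rewrite mulmxDr mulmxDl -scalemxAr -scalemxAl [LHS]mxE [X in _ + X]mxE.
exact/sqrtrD_sqrM_le/sqrtr_ge0.
Qed.
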